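(* Let $p$ satisfy hypothesis (H), with $p_h(t,0)\neq0$ and $1/p_h(\cdot,0)\in L^1(a,b)$. If $f,g$ are both $p$-differentiable on $(a,b)$ and continuous on $[a,b]$, then $$I_p(f\,D_p(g))=fg-I_p(D_p(f)\,g).$$
   Context: Let $I=[a,b]$. Here $p(t,h)$ is a real-valued function defined on $\{(t,h): t\in I,\ |h|<\delta\}$ for some generally unspecified $\delta>0$, with range contained in $I$, and $p_h=\partial p/\partial h$. A function $f:[a,b]\to\mathbb{R}$ is $p$-differentiable at $t$ if $$D_pf(t)=\lim_{h\to0}\frac{f(p(t,h))-f(t)}{h}$$ exists and is finite. The operator $I_p$ is defined (for continuous $u:[a,b]\to\mathbb{R}$) by $$I_p(u)(t)=\int_a^t\frac{u(x)}{p_h(x,0)}\,dx.$$ Hypothesis (H): for $t\in I$, the functions $p(t,h)$ and $p_h(t,h)$ are continuous in a neighborhood of $h=0$; and for $t\in I$ and for all sufficiently small $\varepsilon>0$, the equation $p(t,h)=t\pm\varepsilon$ has a solution $h=h(t,\varepsilon)$ such that $h\to0$ as $\varepsilon\to0$.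
   Formalization: The term fg is read as f(t)g(t)-f(a)g(a) (the printed formula fails for f=g=1); both integrands of I_p are assumed in L^1(a,b) so that I_p is defined; the range condition, (H) and p_h(t,0)≠0 are required only at interior t, as they conflict at the endpoints. *)

(* Defs.v *)
From HB Require Import structures.
From mathcomp Require Import all_boot all_order all_algebra.
From mathcomp Require Import all_classical all_reals all_analysis.
From mathcomp Require Import measurable_realfun.

Set Implicit Arguments.
Unset Strict Implicit.
Unset Printing Implicit Defensive.

Import Order.TTheory GRing.Theory Num.Theory.
Import numFieldNormedType.Exports.

Local Open Scope classical_set_scope.
Local Open Scope ring_scope.

(* Functions on [a, b], or on {(t, h) : t in [a, b], |h| < delta}, are total
   here; only their values on those sets matter. *)

(* p_h = dp/dh *)
Definition ph (R : realType) (p : R -> R -> R) (t h : R) : R := derive1 (p t) h.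

Definition p_quotient (R : realType) (p : R -> R -> R) (f : R -> R) (t h : R)
  : R := (f (p t h) - f t) / h.

Definition p_differentiable (R : realType) (p : R -> R -> R) (f : R -> R)
  (t : R) : Prop := cvg (p_quotient p f t h @[h --> 0^']).

Definition Dp (R : realType) (p : R -> R -> R) (f : R -> R) (t : R) : R :=
  lim (p_quotient p f t h @[h --> 0^']).

(* The bound delta is allowed to depend on t, and t is interior: with
   p t 0 = t and p_h t 0 != 0, the function p t takes values on both sides of
   t, so p a and p b cannot have their range in [a, b] near h = 0. *)
Definition range_in (R : realType) (p : R -> R -> R) (a b : R) : Prop :=
  forall t, t \in `]a, b[ -> exists2 delta : R, 0 < delta &
    forall h, `|h| < delta -> p t h \in `[a, b].

(* Hypothesis (H), at interior points t for the same reason: p t h = b + e has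
   no solution when the range of p is in [a, b]. *)
Definition hypH (R : realType) (p : R -> R -> R) (a b : R) : Prop :=
  forall t, t \in `]a, b[ ->
  [/\ \forall h \near 0, derivable (p t) h 1,
      \forall h \near 0,
        {for h, continuous (p t)} /\ {for h, continuous (ph p t)},
      exists2 hp : R -> R, (\forall e \near 0^'+, p t (hp e) = t + e) &
        hp e @[e --> 0^'+] --> 0
    & exists2 hm : R -> R, (\forall e \near 0^'+, p t (hm e) = t - e) &
        hm e @[e --> 0^'+] --> 0].

Definition L1 (R : realType) (a b : R) (u : R -> R) : Prop :=
  (@lebesgue_measure R).-integrable `]a, b[ (EFin \o u).

Definition Ip (R : realType) (p : R -> R -> R) (a : R) (u : R -> R) (t : R)
  : R := \int[@lebesgue_measure R]_(x in `[a, t]) (u x / ph p x 0).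

(* The functions u whose integral I_p(u) exists on [a, b]. *)
Definition Ip_dom (R : realType) (p : R -> R -> R) (a b : R) (u : R -> R)
  : Prop := L1 a b (fun x => u x / ph p x 0).

Lemma continuous_Ip_dom (R : realType) (p : R -> R -> R) (a b : R)
    (u : R -> R) :
  L1 a b (fun x => (ph p x 0)^-1) -> {within `[a, b], continuous u} ->
  Ip_dom p a b u.
Proof.
move=> ip cu.
have sub : `]a, b[ `<=` `[a, b] by exact: subset_itv_oo_cc.
have mu : measurable_fun `]a, b[ u.
  apply: (measurable_funS _ sub) => //.
  exact: subspace_continuous_measurable_fun.
have bu : [bounded u x | x in `]a, b[%classic].
  have /compact_bounded[M [Mr Mu]] :=
    continuous_compact cu (@segment_compact _ a b).
  exists M; split => // y My x xab.
  by apply: Mu => //=; exists x => //; exact: sub.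
rewrite /Ip_dom /L1.
rewrite (_ : EFin \o _ =
  ((EFin \o u) \* (EFin \o (fun x => (ph p x 0)^-1)%R))%E).
  by apply: integrableMr.
by apply/funext => x /=; rewrite EFinM.
Qed.

(* Main.v *)
Require Import Defs.
From HB Require Import structures.
From mathcomp Require Import all_boot all_order all_algebra.
From mathcomp Require Import all_classical all_reals all_analysis.
From mathcomp Require Import measurable_realfun ring lra.

(** The [p]-derivative is an ordinary derivative in disguise. At an interior
    point [t], solvability of [p t h = t + e] with [h] tending to [0] forces
    [p t 0 = t]; substituting that solution [h] for the increment turns the
    difference quotient of [f] at [t] into the quotient defining [Dp p f t]
    divided by [(p t h - t) / h]. Hence [f] is differentiable at [t], with
    derivative [Dp p f t / ph p t 0] ([p_differentiable_is_derive]). The two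
    integrands of the statement are therefore [f * g'] and [f' * g], and
    everything reduces to [\int_a^t (f * g)' = (f * g) t - (f * g) a].

    The difficulty is that [(f * g)'] is only known to be Lebesgue integrable:
    it need not be continuous, and no absolute continuity is given. What is
    needed is the fundamental theorem of calculus for a function that is
    continuous on a closed interval and differentiable at every interior point,
    with an integrable derivative ([integral_derive]). Its core is the
    inequality [F b - F a <= \int F'], the other one following by applying it
    to [- F].

    For a nonnegative integrable [w >= F'] the inequality comes from an argument
    in the spirit of Vitali and Caratheodory. Up to [e] in the integral, [w] has
    a measurable majorant [u] that still dominates the value [w x] in a whole
    neighborhood of each [x] ([local_majorant]). The primitive of [u], plus a
    linear term of small slope, then grows at least as fast as [F] immediately
    to the right of each point, and such a local comparison propagates to the
    whole interval ([le_increment]). The sign condition on [w] is removed by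
    adding [n x] to [F], which amounts to comparing [F'] with its truncation
    [max(F', - n)], and by letting [n] tend to infinity under the integral
    sign. *)

Set Implicit Arguments.
Unset Strict Implicit.
Unset Printing Implicit Defensive.

Import Order.TTheory GRing.Theory Num.Theory.
Import numFieldNormedType.Exports.

Local Open Scope classical_set_scope.
Local Open Scope ring_scope.

Section fundamental_theorem.
Context {R : realType}.
Local Notation mu := (@lebesgue_measure R).

(** * Majorants that dominate a function locally *)

(** Cut [D] into the slices [E k] where [k * eta <= w < (k + 1) * eta], enclose
    each slice in an open set [U k] of almost the same measure, and add up the
    functions equal to [(k + 1) * eta] on [U k] and to [0] elsewhere. Openness
    of the [U k] makes the majoration local; the excess of the integral is at
    most [eta * mu D] for the slicing plus the weighted measures of the sets
    [U k `\` E k]. *)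
Lemma local_majorant (D : set R) (w : R -> R) (e : R) :
  measurable D -> (mu D < +oo)%E -> measurable_fun D w ->
  (forall x, D x -> 0 <= w x) -> 0 < e ->
  exists u : R -> \bar R, [/\ measurable_fun setT u,
    forall x, (0 <= u x)%E,
    forall x, D x -> \forall y \near x, ((w x)%:E <= u y)%E
  & (\int[mu]_x u x <= \int[mu]_(x in D) (w x)%:E + e%:E)%E].
Proof.
move=> mD Dfin mw w0 e0.
pose m := fine (mu D).
have m0 : 0 <= m by rewrite fine_ge0.
have Dm : mu D = m%:E by rewrite fineK// ge0_fin_numE.
(* the [+ 1] keeps the denominator positive when [D] is null *)
pose eta : R := e / 2 / (m + 1).
have eta0 : 0 < eta by apply: divr_gt0; [exact: divr_gt0|exact: ltr_wpDl].
pose c (k : nat) : R := k.+1%:R * eta.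
have c0 k : 0 < c k by rewrite mulr_gt0.
pose E k := D `&` w @^-1` `[k%:R * eta, c k[.
have mE k : measurable (E k) by apply: mw => //; exact: measurable_itv.
have ED k : E k `<=` D by move=> x [].
have Efin k : (mu (E k) < +oo)%E.
  apply: le_lt_trans Dfin; apply: le_measure; last exact: ED.
  - exact: mem_set (mE k).
  - exact: mem_set mD.
have wetaE x : D x -> E (Num.truncn (w x / eta)) x.
  move=> Dx; split => //=.
  have /truncn_itv/andP[] : 0 <= w x / eta by rewrite divr_ge0 ?w0 ?(ltW eta0).
  by rewrite in_itv/= ler_pdivlMr// ltr_pdivrMr// => -> ->.
have UE : \bigcup_k E k = D.
  apply/seteqP; split=> [x [k _] /ED//|x Dx].
  by exists (Num.truncn (w x / eta)) => //; exact: wetaE.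
(* the slices are the level sets of the integer part of [w / eta] *)
have truncE k x : E k x -> Num.truncn (w x / eta) = k.
  move=> [Dx]; rewrite /= in_itv/= -ler_pdivlMr// -ltr_pdivrMr//.
  exact: truncn_def.
have tE : trivIset setT E.
  apply/trivIsetP => i j _ _ ij; apply/seteqP; split => // x /= [].
  by move=> /truncE ix /truncE jx; rewrite -ix -jx eqxx in ij.
pose d (k : nat) : R := e / 2 / (2 ^ k.+1)%:R.
have d0 k : 0 < d k by apply: divr_gt0; rewrite ?divr_gt0 ?ltr0n ?expn_gt0.
(* dividing by the height [c k] leaves an excess [d k] in the integral of the
   [k]-th step, and the [d k] add up to [e / 2] *)
have /choice[U HU] k : exists U, [/\ open U, E k `<=` U &
    (mu (U `\` E k) < (d k / c k)%:E)%E].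
  by apply: lebesgue_regularity_outer; [exact: mE|exact: Efin|exact: divr_gt0].
have oU k : open (U k) by have [] := HU k.
have EU k : E k `<=` U k by have [] := HU k.
have mU k : measurable (U k) by exact: open_measurable.
pose s k y : \bar R := (c k * \1_(U k) y)%:E.
have ms k : measurable_fun setT (s k).
  by apply/measurable_EFinP; apply: measurable_funM => //;
    exact: measurable_indic.
have s0 k y : (0 <= s k y)%E by rewrite lee_fin mulr_ge0// ltW.
pose u y := (\sum_(k <oo) s k y)%E.
exists u; split.
- exact: ge0_emeasurable_sum.
- by move=> x; apply: nneseries_ge0.
- move=> x Dx; set k := Num.truncn (w x / eta).
  have Ek := wetaE _ Dx.
  have : nbhs x (U k) by apply: open_nbhs_nbhs; split => //; exact: EU.
  apply: filterS => y Uy.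
  apply: (@le_trans _ _ (s k y)).
    rewrite /s indicE mem_set// mulr1 lee_fin.
    by case: Ek => _ /=; rewrite in_itv/= => /andP[_ /ltW].
  by rewrite /u (nneseriesD1 (n := k))// leeDl// nneseries_ge0.
rewrite integral_nneseries//.
have sE k : (\int[mu]_x s k x = (c k)%:E * mu (U k))%E.
  rewrite /s; under eq_integral do rewrite EFinM.
  rewrite ge0_integralZl_EFin ?(ltW (c0 k))//.
    by rewrite integral_indic//; [rewrite setIT|exact: mU].
  by apply/measurable_EFinP; apply: measurable_indic; exact: mU.
apply: (@le_trans _ _ (\sum_(k <oo) ((\int[mu]_(x in E k) (w x + eta)%:E)
   + (d k)%:E))%E).
  apply: lee_nneseries => k _; first by move=> _; exact: integral_ge0.
  rewrite sE.
  have -> : mu (U k) = (mu (E k) + mu (U k `\` E k))%E.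
    rewrite -measureU; [by rewrite setDUK|exact: mE| |exact: setDIK].
    by apply: measurableD; [exact: mU|exact: mE].
  rewrite ge0_muleDr//; apply: leeD.
    rewrite -integral_cst; last exact: mE.
    apply: ge0_le_integral => //; first exact: mE.
    - by move=> x _; rewrite lee_fin ltW.
    - apply/measurable_EFinP; apply: measurable_funD => //.
      exact: measurable_funS mw.
    - move=> x [_ /=]; rewrite in_itv/= => /andP[kx _].
      by rewrite lee_fin /c -natr1 mulrDl mul1r lerD2r.
  have [_ _ /ltW] := HU k.
  move=> /(lee_wpmul2l (_ : 0 <= (c k)%:E)%E) h.
  apply: le_trans (h _) _; first by rewrite lee_fin ltW.
  by rewrite -EFinM mulrCA divff ?mulr1// gt_eqF.
apply: le_trans (epsilon_trick _ _ _) _ => //.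
- move=> k; apply: integral_ge0 => x /ED Dx.
  by rewrite lee_fin addr_ge0 ?w0// ltW.
- by rewrite divr_ge0// ltW.
rewrite -ge0_integral_bigcup//; last 2 first.
- rewrite UE; apply/measurable_EFinP; exact: measurable_funD.
- by move=> x; rewrite UE => Dx; rewrite lee_fin addr_ge0 ?w0// ltW.
rewrite UE; under eq_integral do rewrite EFinD.
rewrite ge0_integralD//; last 2 first.
- exact/measurable_EFinP.
- by move=> x _; rewrite lee_fin ltW.
rewrite integral_cst//= Dm -addeA leeD2l// -!EFinD lee_fin.
suff : eta * m <= e / 2 by lra.
rewrite /eta mulrAC ler_pdivrMr ?ltr_wpDl//.
by rewrite ler_wpM2l ?divr_ge0 ?(ltW e0)// lerDl.
Qed.

(** * Growth comparison *)

(** Let [s] be the supremum of the points [x] at which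
    [F x - F c <= Phi x - Phi c]. Left continuity of [F], together with
    monotonicity of [Phi], shows that this still holds at [s]; if [s < b], the
    local comparison to the right of [s] then carries it beyond [s], a
    contradiction. *)
Lemma le_increment (F Phi : R -> R) (c b : R) : c <= b ->
  {in `[c, b] &, {homo Phi : x y / x <= y}} ->
  (forall s, s \in `]c, b] -> F x @[x --> s^'-] --> F s) ->
  (forall x, x \in `[c, b[ ->
    \forall h \near 0^'+, F (x + h) - F x <= Phi (x + h) - Phi x) ->
  F b - F c <= Phi b - Phi c.
Proof.
move=> cb hPhi cF lF.
pose S := [set x | x \in `[c, b] /\ F x - F c <= Phi x - Phi c].
have Sc : S c by split; rewrite ?subrr// in_itv/= lexx.
have Sb : ubound S b by move=> x [/itvP xcb _]; rewrite xcb.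
have hS : has_sup S by split; [exists c|exists b].
have cs : c <= sup S by apply: ub_le_sup => //; case: hS.
have sb : sup S <= b by apply: ge_sup => //; exists c.
have Ss : S (sup S).
  split; first by rewrite in_itv/= cs.
  have [sc|/eqP sc] := eqVneq (sup S) c; first by rewrite sc !subrr.
  rewrite leNgt; apply/negP => hlt.
  have csb : sup S \in `]c, b].
    by rewrite in_itv/= sb andbT lt_neqAle cs eq_sym (introF eqP sc).
  have : \forall x \near (sup S)^'-, F c + (Phi (sup S) - Phi c) < F x.
    by have /cvgr_gt := cF _ csb; apply; lra.
  rewrite near_withinE => -[d /= d0 hd].
  have [x [xcb Fx] dx] := sup_adherent d0 hS.
  have xs : x <= sup S by apply: ub_le_sup => //; case: hS.
  have Phix : Phi x <= Phi (sup S) by apply: hPhi => //; rewrite in_itv/= cs.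
  have [xs'|xs'] := eqVneq x (sup S).
    by move: Fx; rewrite xs' leNgt hlt.
  have := hd x; rewrite /ball/= ger0_norm ?subr_ge0// ltrBlDl -ltrBlDr dx.
  rewrite lt_neqAle xs' xs.
  by move=> /(_ isT isT); lra.
have [<-//|sb'] := eqVneq (sup S) b; first by case: Ss.
have lsb : sup S < b by rewrite lt_neqAle sb' sb.
have : \forall h \near 0^'+, [/\ 0 < h, sup S + h <= b &
    F (sup S + h) - F (sup S) <= Phi (sup S + h) - Phi (sup S)].
  near=> h; split; first by near: h; exact: nbhs_right_gt.
    rewrite -lerBrDl; near: h; apply: nbhs_right_le; by rewrite subr_gt0.
  by near: h; apply: lF; rewrite in_itv/= cs.
move=> /filter_ex[h [h0 hb hF]].
case: Ss => _ Ss.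
have : S (sup S + h).
  split; first by rewrite in_itv/= hb andbT (le_trans cs)// lerDl ltW.
  by lra.
by move=> /(ub_le_sup (ex_intro _ b Sb)); rewrite leNgt ltrDl h0.
Unshelve. all: by end_near. Qed.

(** * The fundamental theorem of calculus for integrable derivatives *)

(** [F] is compared with the increasing function [Phi x = G x + eta * x], where
    [G] is the primitive of a local majorant of [w]. Just to the right of [x],
    the increments of [F] over [h] are below [(w x + eta) * h] because
    [F' x <= w x], whereas those of [G] are above [w x * h]. *)
Lemma increment_le_integral_majorant (F dF w : R -> R) (a b : R) : a < b ->
  {within `[a, b], continuous F} ->
  (forall x, x \in `]a, b[ -> is_derive x 1 F (dF x)) ->
  mu.-integrable `]a, b[ (EFin \o w) ->
  (forall x, x \in `]a, b[ -> 0 <= w x) ->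
  (forall x, x \in `]a, b[ -> dF x <= w x) ->
  ((F b - F a)%:E <= \int[mu]_(x in `]a, b[) (w x)%:E)%E.
Proof.
move=> ab /(continuous_within_itvP _ ab)[cF Fa Fb] hF iw w0 dFw.
apply/lee_addgt0Pr => e e0.
have mab : measurable `]a, b[ by exact: measurable_itv.
have muab : (mu `]a, b[ < +oo)%E.
  by rewrite lebesgue_measure_itv/= lte_fin ab -EFinD ltry.
have mw : measurable_fun `]a, b[ w.
  by apply/measurable_EFinP; case/integrableP: iw.
have [u [mu_ u0 uw Iu]] : exists u : R -> \bar R, [/\ measurable_fun setT u,
    forall x, (0 <= u x)%E,
    forall x, x \in `]a, b[ -> \forall y \near x, ((w x)%:E <= u y)%E
  & (\int[mu]_x u x <= \int[mu]_(x in `]a, b[) (w x)%:E + (e / 2)%:E)%E].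
  exact: (local_majorant mab muab mw w0 (divr_gt0 e0 (ltr0Sn _ 1))).
have Iw : (\int[mu]_(x in `]a, b[) (w x)%:E)%E \is a fin_num.
  exact: integrable_fin_num.
have Iufin : (\int[mu]_x u x < +oo)%E.
  by apply: (le_lt_trans Iu); rewrite -(fineK Iw) -EFinD ltry.
have sub (A : set R) : measurable A -> (\int[mu]_(x in A) u x)%E \is a fin_num.
  move=> mA; rewrite ge0_fin_numE ?integral_ge0//.
  by apply: le_lt_trans Iufin; apply: ge0_subset_integral.
pose G x := fine (\int[mu]_(y in `]-oo, x]) u y)%E.
have GB x y : x <= y -> (G y - G x)%:E = (\int[mu]_(z in `]x, y]) u z)%E.
  move=> xy; rewrite EFinB /G !fineK ?sub//.
  rewrite (@itv_bndbnd_setU _ _ -oo%O (BRight x) (BRight y))//.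
  rewrite ge0_integral_setU//=.
  - by rewrite addeAC subee ?add0e// sub.
  - exact: measurable_funS mu_.
  - apply/disj_set2P/seteqP; split=> // z /= [].
    by rewrite !in_itv/= => zx /andP[]; rewrite ltNge zx.
pose eta := e / 2 / (b - a).
have eta0 : 0 < eta by rewrite !divr_gt0 ?subr_gt0.
pose Phi x := G x + eta * x.
have GE x y : x <= y -> G x <= G y.
  by move=> xy; rewrite -subr_ge0 -lee_fin GB// integral_ge0.
(* [F] is differentiable only inside the interval, so the comparison starts
   from a point [c > a], and [a] is reached by continuity *)
suff key c : c \in `]a, b[ ->
    ((F b - F c)%:E <= \int[mu]_(x in `]a, b[) (w x)%:E + e%:E)%E.
  rewrite -(fineK Iw) -EFinD in key *; move: (_ + e) key => K key.
  rewrite lee_fin leNgt; apply/negP => lt.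
  have : F a < F b - K by lra.
  move/cvgr_lt : Fa => /[apply] Fa.
  have /filter_ex[c [ac cb Fc]] : \forall c \near a^'+,
      [/\ a < c, c < b & F c < F b - K].
    near=> c; split; near: c => //; [exact: nbhs_right_gt|exact: nbhs_right_lt].
  have : c \in `]a, b[ by rewrite in_itv/= ac.
  by move=> /key; rewrite lee_fin; lra.
move=> /itvP cab.
have : F b - F c <= Phi b - Phi c.
  apply: le_increment.
  - by rewrite cab.
  - move=> x y _ _ xy; rewrite lerD ?GE//.
    by rewrite ler_pM2l.
  - move=> s; rewrite in_itv/= => /andP[cs].
    rewrite le_eqVlt => /predU1P[->//|sb].
    apply: cvg_at_left_filter; apply: cF.
    by rewrite in_itv/= sb (lt_trans _ cs)// cab.
  move=> x; rewrite in_itv/= => /andP[cx xb].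
  have xab : x \in `]a, b[ by rewrite in_itv/= xb (lt_le_trans _ cx)// cab.
  have [dx dxE] := hF _ xab.
  have /cvg_dnbhs_at_right/cvgr_lt h1 :
      h^-1 *: ((F \o shift x) (h *: 1) - F x) @[h --> 0^'] --> dF x.
    by rewrite -dxE; exact: dx.
  have /h1 {}h1 : dF x < w x + eta.
    by rewrite (le_lt_trans (dFw _ xab))// ltrDl.
  have /nbhsr0P ux := uw _ xab.
  near=> h.
  have h0 : 0 < h by near: h; exact: nbhs_right_gt.
  have q : h^-1 * (F (x + h) - F x) < w x + eta.
    have : h^-1 *: ((F \o shift x) (h *: 1) - F x) < w x + eta.
      by near: h.
    by rewrite /= /GRing.scale/= mulr1 [h + x]addrC.
  rewrite mulrC ltr_pdivrMr// in q.
  apply: (le_trans (ltW q)).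
  rewrite (_ : Phi (x + h) - Phi x = (G (x + h) - G x) + eta * h); last first.
    by rewrite /Phi; ring.
  rewrite mulrDl lerD2r -lee_fin GB ?lerDl ?(ltW h0)//.
  have -> : (w x * h)%:E = (\int[mu]_(z in `]x, (x + h)%R]) (w x)%:E)%E.
    rewrite integral_cst//= lebesgue_measure_itv/= lte_fin ltrDl h0 -EFinD.
    by rewrite -EFinM addrAC subrr add0r.
  apply: ge0_le_integral => //.
  - by move=> z _; rewrite lee_fin w0.
  - exact: measurable_funS mu_.
  - move=> z; rewrite /= in_itv/= => /andP[xz zh].
    have uxh : forall y, `|x - y| <= h -> ((w x)%:E <= u y)%E by near: h.
    by apply: uxh; rewrite distrC gtr0_norm ?subr_gt0// lerBlDl.
rewrite -lee_fin => /le_trans; apply.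
rewrite (_ : Phi b - Phi c = (G b - G c) + eta * (b - c)); last first.
  by rewrite /Phi; ring.
rewrite EFinD GB ?cab//.
apply: (@le_trans _ _
  ((\int[mu]_(x in `]a, b[) (w x)%:E + (e / 2)%:E) + (e / 2)%:E)%E).
  apply: leeD.
    by apply: le_trans Iu; apply: ge0_subset_integral.
  rewrite lee_fin /eta mulrAC ler_pdivrMr ?subr_gt0//.
  by rewrite ler_wpM2l ?divr_ge0 ?(ltW e0)// lerD2l lerN2 cab.
by rewrite -addeA -EFinD -splitr.
Unshelve. all: end_near. Qed.

(** The function [F + n x] has a derivative below [max(F', - n) + n], which is
    nonnegative, so the increment of [F] is at most the integral of
    [max(F', - n)]. These truncations are dominated by [`|F'|] and converge to
    [F']. *)
Lemma increment_le_integral_derive (F dF : R -> R) (a b : R) : a < b ->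
  {within `[a, b], continuous F} ->
  (forall x, x \in `]a, b[ -> is_derive x 1 F (dF x)) ->
  mu.-integrable `]a, b[ (EFin \o dF) ->
  ((F b - F a)%:E <= \int[mu]_(x in `]a, b[) (dF x)%:E)%E.
Proof.
move=> ab cF hF idF.
have mab : measurable `]a, b[ by exact: measurable_itv.
have muab : mu `]a, b[ = (b - a)%:E.
  by rewrite lebesgue_measure_itv/= lte_fin ab.
have mdF : measurable_fun `]a, b[ dF.
  by apply/measurable_EFinP; case/integrableP: idF.
pose T (n : nat) x := Num.max (dF x) (- n%:R).
have mT n : measurable_fun `]a, b[ (T n) by exact: measurable_maxr.
have T_le n x : `|T n x| <= `|dF x|.
  rewrite /T; have n0 : 0 <= n%:R :> R by [].
  case: (leP (dF x) (- n%:R)) => // dFn.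
  by rewrite normrN ger0_norm// ler_normr lerNr dFn orbT.
have iT n : mu.-integrable `]a, b[ (EFin \o T n).
  apply: le_integrable idF => //.
    by apply/measurable_EFinP; exact: mT.
  by move=> x _ /=; rewrite lee_fin.
have icst (r : R) : mu.-integrable `]a, b[ (EFin \o cst r).
  apply/integrableP; split; first exact/measurable_EFinP.
  by rewrite /= integral_cst//= [mu _]muab -EFinM ltry.
have main n : ((F b - F a)%:E <= \int[mu]_(x in `]a, b[) (T n x)%:E)%E.
  have : (((F b + n%:R * b) - (F a + n%:R * a))%:E <=
      \int[mu]_(x in `]a, b[) (T n x + n%:R)%:E)%E.
    apply: (increment_le_integral_majorant (F := fun x => F x + n%:R * x)
      (dF := fun x => dF x + n%:R)) => //.
    - apply: within_continuousD => //; apply: continuous_subspaceT.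
      exact: mulrl_continuous.
    - move=> x xab; have ? := hF _ xab; rewrite -[in dF x + _](mulr1 n%:R).
      by apply: is_deriveD; exact: (is_deriveZ n%:R).
    - rewrite (_ : EFin \o _ = (EFin \o T n) \+ (EFin \o cst n%:R))%E//.
      exact: integrableD.
    - by move=> x _; rewrite -lerBlDr sub0r /T le_max lexx orbT.
    - by move=> x _; rewrite lerD2r /T le_max lexx.
  under eq_integral do rewrite EFinD.
  rewrite (integralD _ (iT n) (icst n%:R)); last exact: mab.
  have -> : (\int[mu]_(x in `]a, b[) (EFin \o cst n%:R) x =
      (n%:R * (b - a))%:E)%E.
    by rewrite /= integral_cst//= [mu _]muab -EFinM.
  move=> h.
  rewrite -(leeD2rE _ _ (x := (n%:R * (b - a))%:E))// -EFinD.
  apply: le_trans h; rewrite lee_fin le_eqVlt; apply/orP; left.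
  by apply/eqP; ring.
have [|||||_ _ cvgT] := @dominated_convergence _ _ R mu `]a, b[
  (measurable_itv _)
  (fun n => EFin \o T n) (EFin \o dF) (fun x => `|(dF x)%:E|)%E.
- by move=> n; apply/measurable_EFinP; exact: mT.
- by apply/measurable_EFinP; exact: mdF.
- apply: aeW => x _ /=; apply: cvg_near_cst.
  exists (Num.bound `|dF x|) => // n /= xn; congr EFin; apply/max_idPl.
  rewrite lerNl (le_trans (ler_norm _))// normrN.
  by rewrite (le_trans (ltW (archi_boundP (normr_ge0 _))))// ler_nat.
- exact: integrable_abse.
- by apply: aeW => x n _; rewrite /= lee_fin.
by apply: cvge_ge cvgT; apply: nearW.
Qed.

(** Differentiability at every point of the open interval, not merely almost
    everywhere, is what excludes functions of Cantor type. *)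
Lemma integral_derive (F dF : R -> R) (a b : R) : a < b ->
  {within `[a, b], continuous F} ->
  (forall x, x \in `]a, b[ -> is_derive x 1 F (dF x)) ->
  mu.-integrable `]a, b[ (EFin \o dF) ->
  \int[mu]_(x in `]a, b[) dF x = F b - F a.
Proof.
move=> ab cF hF idF; apply/eqP; rewrite eq_le.
have Ifin : (\int[mu]_(x in `]a, b[) (dF x)%:E)%E \is a fin_num.
  by apply: integrable_fin_num => //; exact: measurable_itv.
have le1 := increment_le_integral_derive ab cF hF idF.
have : ((- F b - - F a)%:E <= \int[mu]_(x in `]a, b[) (- dF x)%:E)%E.
  apply: (increment_le_integral_derive (F := fun x => - F x)
    (dF := fun x => - dF x)) => //.
  - by move=> x; apply: continuousN; exact: cF.
  - by move=> x /hF ?; exact: is_deriveN.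
  - exact: (integrableN idF).
have -> : (\int[mu]_(x in `]a, b[) (- dF x)%:E =
    - \int[mu]_(x in `]a, b[) (dF x)%:E)%E.
  rewrite -integralN; first by [].
  by apply: integrable_add_def => //; exact: measurable_itv.
rewrite -(fineK Ifin) -EFinN !lee_fin in le1 *.
by rewrite /Rintegral; move: le1; lra.
Qed.

End fundamental_theorem.

Section p_calculus.
Context {R : realType}.
Local Notation mu := (@lebesgue_measure R).

(** * The p-derivative as an ordinary derivative *)

(** As [e] tends to [0], the point [p t (hp e) = t + e] tends to [t], and also
    to [p t 0] because [hp e] tends to [0]. *)
Lemma hypH_p0 (p : R -> R -> R) (a b t : R) :
  hypH p a b -> t \in `]a, b[ -> p t 0 = t.
Proof.
move=> H /H[_ cp [hp hpE hp0] _].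
have [cp0 _] := nbhs_singleton cp.
have l1 : p t (hp e) @[e --> 0^'+] --> p t 0.
  by apply: cvg_comp hp0 _; exact: cp0.
have l2 : p t (hp e) @[e --> 0^'+] --> t.
  have : t + e @[e --> 0^'+] --> t + 0.
    by apply: cvgD; [exact: cvg_cst|apply: cvg_at_right_filter; exact: cvg_id].
  rewrite addr0; apply: cvg_trans; apply: near_eq_cvg.
  by apply: filterS hpE => e ->.
by apply: (cvg_unique _ l1 l2).
Qed.

(** This is [(f (q k) - f t) / k] divided by [(q k - t) / k], both evaluated
    along [k = k e]; the equality [q 0 = t] guarantees [k e != 0] as soon as
    [r e != 0]. The filter and the increment [r] are left free so as to cover
    right and left limits. *)
Lemma cvg_quotient_along (F : set_system R) {FF : ProperFilter F} (f q : R -> R)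
  (k r : R -> R) (t l m : R) :
  q 0 = t -> m != 0 ->
  (q h - t) / h @[h --> 0^'] --> m ->
  (f (q h) - f t) / h @[h --> 0^'] --> l ->
  k e @[e --> F] --> 0 ->
  (\forall e \near F, q (k e) = t + r e) -> (\forall e \near F, r e != 0) ->
  (f (t + r e) - f t) / r e @[e --> F] --> l / m.
Proof.
move=> q0 m0 qm fl k0 kE r0.
have ke0 : \forall e \near F, k e != 0.
  near=> e.
  have qk : q (k e) = t + r e by near: e.
  have re0 : r e != 0 by near: e.
  by apply: contra_neq re0 => ke0; move: qk; rewrite ke0 q0; lra.
have kd : k e @[e --> F] --> 0^'.
  move=> A /k0 kA; apply: filterS2 kA ke0 => e; exact.
have fl' := cvg_comp _ _ kd fl.
have qm' := cvg_comp _ _ kd qm.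
apply: cvg_trans (cvgM fl' (cvgV m0 qm')).
apply: near_eq_cvg; near=> e.
have qk : q (k e) = t + r e by near: e.
have ne0 : k e != 0 by near: e.
by rewrite /= qk [t + r e - t]addrAC subrr add0r invf_div mulrA divfK.
Unshelve. all: by end_near. Qed.

(** Right and left limits of the quotient [(f (t + h) - f t) / h] are computed
    separately, along the solutions of [p t h = t + e] and [p t h = t - e]. *)
Lemma p_differentiable_is_derive (p : R -> R -> R) (f : R -> R) (a b t : R) :
  hypH p a b -> t \in `]a, b[ -> ph p t 0 != 0 -> p_differentiable p f t ->
  is_derive t 1 f (Dp p f t / ph p t 0).
Proof.
move=> H tab ph0 fp.
have p0 := hypH_p0 H tab.
have [dp cp [hp hpE hp0] [hm hmE hm0]] := H _ tab.
have qm : (p t h - t) / h @[h --> 0^'] --> ph p t 0.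
  have := nbhs_singleton dp; rewrite /ph derive1E.
  rewrite /derivable /derive p0.
  under eq_fun do rewrite /= addr0 /GRing.scale/= mulr1 mulrC.
  by [].
have lim : (f (t + h) - f t) / h @[h --> 0^'] --> Dp p f t / ph p t 0.
  apply: (@cvg_at_right_left_dnbhs _ R^o).
    apply: (cvg_quotient_along p0 ph0 qm fp hp0 hpE).
    by near=> e; rewrite gt_eqF//; near: e; exact: nbhs_right_gt.
  apply/cvg_at_leftNP; rewrite oppr0.
  apply: (cvg_quotient_along p0 ph0 qm fp hm0 hmE).
  by near=> e; rewrite oppr_eq0 gt_eqF//; near: e; exact: nbhs_right_gt.
have E : (fun h => h^-1 *: ((f \o shift t) (h *: 1) - f t)) =
    (fun h => (f (t + h) - f t) / h).
  by apply/funext => h; rewrite /= /GRing.scale/= mulr1 [h + t]addrC mulrC.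
apply: DeriveDef; rewrite /derivable /derive E.
  by apply/cvg_ex; exists (Dp p f t / ph p t 0).
exact: cvg_lim.
Unshelve. all: by end_near. Qed.

(** * Integration by parts *)

Lemma Ip_itvoo (p : R -> R -> R) (u : R -> R) (a b t : R) :
  a < t <= b -> Ip_dom p a b u ->
  mu.-integrable `]a, t[ (EFin \o (fun x => u x / ph p x 0)) /\
  Ip p a u t = \int[mu]_(x in `]a, t[) (u x / ph p x 0).
Proof.
move=> /andP[a_t tb] du.
have it : mu.-integrable `]a, t[ (EFin \o (fun x => u x / ph p x 0)).
  apply: integrableS du; [exact: measurable_itv|exact: measurable_itv|].
  by apply: subset_itvl; rewrite bnd_simp.
split=> //; rewrite /Ip /Rintegral integral_itv_bndoo//.
by case/integrableP: it.
Qed.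

Lemma within_continuous_mul (A : set R) (f g : R -> R) :
  {within A, continuous f} -> {within A, continuous g} ->
  {within A, continuous (f * g)}.
Proof. by move=> cf cg x; apply: continuousM; [exact: cf|exact: cg]. Qed.

End p_calculus.

Theorem corollary4p3 (R : realType) (a b : R) (p : R -> R -> R) (f g : R -> R)
  (hab : a < b)
  (hrange : range_in p a b)
  (hH : hypH p a b)
  (hp0 : forall t, t \in `]a, b[ -> ph p t 0 != 0)
  (hL1 : L1 a b (fun t => (ph p t 0)^-1))
  (fp : forall t, t \in `]a, b[ -> p_differentiable p f t)
  (gp : forall t, t \in `]a, b[ -> p_differentiable p g t)
  (fc : {within `[a, b], continuous f})
  (gc : {within `[a, b], continuous g})
  (fDg : Ip_dom p a b (fun x => f x * Dp p g x))
  (Dfg : Ip_dom p a b (fun x => Dp p f x * g x)) :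
  forall t, t \in `[a, b] ->
    Ip p a (fun x => f x * Dp p g x) t =
    (f t * g t - f a * g a) - Ip p a (fun x => Dp p f x * g x) t.
Proof.
move=> t; rewrite in_itv/= le_eqVlt => /andP[/predU1P[<- _|a_t tb]].
  by rewrite /Ip set_itv1 !Rintegral_set1 !subrr.
have hat : a < t <= b by rewrite a_t.
have [i1 ->] := Ip_itvoo hat fDg.
have [i2 ->] := Ip_itvoo hat Dfg.
have cF : {within `[a, t], continuous (f * g)}.
  have sub : `[a, t] `<=` `[a, b] by apply: subset_itvl; rewrite bnd_simp.
  apply: within_continuous_mul.
    exact: continuous_subspaceW fc.
  exact: continuous_subspaceW gc.
apply/eqP; rewrite eq_sym subr_eq eq_sym; apply/eqP.
rewrite -RintegralD//.
apply: (integral_derive (F := f * g)) => // [x xat|].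
  have xab : x \in `]a, b[.
    by move: xat; rewrite !in_itv/= => /andP[-> xt]; rewrite (lt_le_trans xt).
  have df := p_differentiable_is_derive hH xab (hp0 _ xab) (fp _ xab).
  have dg := p_differentiable_is_derive hH xab (hp0 _ xab) (gp _ xab).
  rewrite (_ : _ + _ =
    f x *: (Dp p g x / ph p x 0) + g x *: (Dp p f x / ph p x 0)).
    exact: (is_deriveM df dg).
  by rewrite /GRing.scale/=; ring.
exact: (integrableD _ i1 i2).
Qed.
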